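(* Let $d\ge 1$ be an integer, let $F\subset \mathbb{R}_+\times\mathbb{R}^d$ and let $H,H'\in(0,1)$ with $H<H'$. Then $$\max\left\{\dim_{\Psi,H}(F),\ \frac{H'}{H}\dim_{\Psi,H}(F)+1-\frac{H'}{H}\right\}\ \le\ \dim_{\Psi,H'}(F)\ \le\ \min\left\{\frac{H'}{H}\dim_{\Psi,H}(F),\ \dim_{\Psi,H}(F)+(H'-H)d\right\}.$$ Equivalently, $$\max\left\{\frac{H}{H'}\dim_{\rho_H}(F),\ \dim_{\rho_H}(F)+\frac{1}{H'}-\frac1H\right\}\ \le\ \dim_{\rho_{H'}}(F)\ \le\ \min\left\{\dim_{\rho_H}(F),\ d+\frac{H}{H'}\left(\dim_{\rho_H}(F)-d\right)\right\}.$$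
   Context: For $H\in(0,1)$, $\beta>0$ and $F\subset\mathbb{R}_+\times\mathbb{R}^d$, the $H$-parabolic $\beta$-dimensional Hausdorff content is $$\Psi_H^\beta(F)=\inf\Big\{\sum_j\delta_j^\beta:\ F\subseteq\bigcup_j [a_j,a_j+\delta_j]\times[b_{j,1},b_{j,1}+\delta_j^H]\times\cdots\times[b_{j,d},b_{j,d}+\delta_j^H]\Big\},$$ the infimum being over all countable covers of $F$ by sets of this form. The $H$-parabolic Hausdorff dimension is $\dim_{\Psi,H}(F)=\inf\{\beta>0:\Psi_H^\beta(F)=0\}$. Let $\rho_H$ be the metric on $\mathbb{R}_+\times\mathbb{R}^d$ given by $\rho_H((s,x),(t,y))=\max\{|s-t|^H,\|x-y\|_\infty\}$, where $\|\cdot\|_\infty$ is the maximum norm. Put $\mathcal{H}_{\rho_H}^\beta(F)=\inf\{\sum_j \mathrm{diam}(U_j)^\beta: F\subseteq\bigcup_j U_j\}$, the infimum being over countable covers of $F$ by arbitrary sets, with diameters taken with respect to $\rho_H$. The Hausdorff dimension of $F$ in the metric $\rho_H$ is $\dim_{\rho_H}(F)=\inf\{\beta>0:\mathcal{H}_{\rho_H}^\beta(F)=0\}$. One has $\dim_{\Psi,H}(F)=H\dim_{\rho_H}(F)$. *)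

(* Defs.v *)
From mathcomp Require Import all_boot all_order all_algebra.
From mathcomp Require Import all_classical all_reals all_analysis.
Import Order.TTheory GRing.Theory Num.Theory.
Import numFieldNormedType.Exports.

Set Implicit Arguments.
Unset Strict Implicit.
Unset Printing Implicit Defensive.

Local Open Scope classical_set_scope.
Local Open Scope ring_scope.

Definition half_space (R : realType) (d : nat) : set (R * 'rV[R]_d) :=
  [set p : R * 'rV[R]_d | 0 <= p.1].
Arguments half_space {R d}.

Definition parabolic_box (R : realType) (d : nat) (H a delta : R)
    (b : 'rV[R]_d) : set (R * 'rV[R]_d) :=
  [set p : R * 'rV[R]_d | a <= p.1 <= a + delta /\
           forall i : 'I_d, b ord0 i <= p.2 ord0 i <= b ord0 i + delta `^ H].

(* Covers are indexed by nat. As beta > 0 in every use, finite covers are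
   included by padding with boxes of size 0, which contribute 0 `^ beta = 0. *)
Definition parabolic_content (R : realType) (d : nat) (H beta : R)
    (F : set (R * 'rV[R]_d)) : \bar R :=
  ereal_inf [set s | exists (a delta : nat -> R) (b : nat -> 'rV[R]_d),
    [/\ forall j, 0 <= delta j,
        F `<=` \bigcup_j parabolic_box H (a j) (delta j) (b j) &
        s = (\sum_(0 <= j <oo) (delta j `^ beta)%:E)%E]].

(* Here and in dim_rho the infimum is taken in the extended reals, so that the
   infimum of a set needs no side condition. *)
Definition dim_Psi (R : realType) (d : nat) (H : R)
    (F : set (R * 'rV[R]_d)) : \bar R :=
  ereal_inf [set beta%:E | beta in
    [set beta : R | 0 < beta /\ parabolic_content H beta F = 0%E]].

(* The norm on 'rV[R]_d is the maximum norm. *)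
Definition rho (R : realType) (d : nat) (H : R) (p q : R * 'rV[R]_d) : R :=
  Num.max (`|p.1 - q.1| `^ H) `|p.2 - q.2|.

(* The maximum with 0 only matters for the empty set, whose supremum is -oo. *)
Definition diam_rho (R : realType) (d : nat) (H : R)
    (U : set (R * 'rV[R]_d)) : \bar R :=
  maxe 0%E (ereal_sup [set (rho H p q)%:E | p in U & q in U]).

Definition rho_content (R : realType) (d : nat) (H beta : R)
    (F : set (R * 'rV[R]_d)) : \bar R :=
  ereal_inf [set s | exists U : nat -> set (R * 'rV[R]_d),
    [/\ forall j, U j `<=` half_space,
        F `<=` \bigcup_j U j &
        s = (\sum_(0 <= j <oo) diam_rho H (U j) `^ beta)%E]].

Definition dim_rho (R : realType) (d : nat) (H : R)
    (F : set (R * 'rV[R]_d)) : \bar R :=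
  ereal_inf [set beta%:E | beta in
    [set beta : R | 0 < beta /\ rho_content H beta F = 0%E]].

(* Main.v *)
Require Import Defs.
From mathcomp Require Import all_boot all_order all_algebra.
From mathcomp Require Import all_classical all_reals all_analysis.
From mathcomp Require Import ring lra.
Import Order.TTheory GRing.Theory Num.Theory.
Import numFieldNormedType.Exports.

(** Both the parabolic and the metric content vanish exactly when the set has
countable covers of arbitrarily small total weight. Hence, to compare two such
dimensions, it is enough to replace each single covering set of small weight by
finitely many covering sets of the other kind, losing at most a constant factor
in the weight: the concatenated covers still have arbitrarily small weight
([null_cover_transfer]). A replacement that turns every null exponent [beta]
into a null exponent [p * beta + q] gives an affine inequality between the
dimensions ([ereal_inf_le_affine]).

For [H < H'], four replacements of boxes of size [delta <= 1] give the four
inequalities for [dim_Psi].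
- The [H']-box of size [delta] lies in the [H]-box of size [delta], whose
  spatial sides are longer ([dim_Psi_le]).
- The [H]-box of size [delta] lies in the [H']-box of size
  [delta `^ (H / H')], which has the same spatial sides and is longer in time
  ([dim_Psi_le_ratio]).
- The [H']-box of size [delta] is cut along the time axis into about
  [delta `^ (1 - H' / H)] boxes of the [H]-size [delta `^ (H' / H)]
  ([dim_Psi_le_time_subdivision]).
- The [H]-box of size [delta] is cut along the [d] spatial axes into about
  [delta `^ ((H - H') * d)] boxes of the same size for [H']
  ([dim_Psi_le_space_subdivision]).

The identity between [dim_Psi] and [H] times [dim_rho] ([dim_Psi_eq]) comes from
the same principle: a box of size [delta] has [rho]-diameter at most
[delta `^ H], and a set of [rho]-diameter [D] lies in a box of size
[(2 * D) `^ H^-1]. It turns the bounds on [dim_Psi] into those on [dim_rho]. *)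

Local Open Scope classical_set_scope.
Local Open Scope ring_scope.

(** * Covers of arbitrarily small total weight *)

(** The two contents differ only in the family [S] of covering sets, indexed by
the admissible parameters [D], and in their weights [w]; this is the common form
of their vanishing. *)
Definition null_cover {R : realType} {X I : Type} (D : set I)
    (S : I -> set X) (w : I -> \bar R) (F : set X) : Prop :=
  forall e : R, 0 < e -> exists t : nat -> I,
    [/\ forall j, D (t j), F `<=` \bigcup_j S (t j) &
        (\sum_(0 <= j <oo) w (t j) < e%:E)%E].

Lemma ereal_inf_eq0P {R : realType} (A : set \bar R) :
  (forall x, A x -> (0 <= x)%E) ->
  ereal_inf A = 0%E <-> (forall e : R, 0 < e -> exists2 x, A x & (x < e%:E)%E).
Proof.
move=> A0; split=> [Aeq0 e e0|small].
  by apply: ereal_inf_lt; rewrite Aeq0 lte_fin.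
apply/eqP; rewrite eq_le; apply/andP; split; last exact: le_ereal_inf_tmp.
apply/lee_addgt0Pr => e e0; have [x Ax xe] := small e e0.
by rewrite add0e (le_trans (ereal_inf_lbound Ax))// ltW.
Qed.

Lemma nneseries_flatten {R : realType} (a : nat -> nat -> \bar R)
    (f : nat -> nat * nat) : set_bij setT setT f ->
  (forall j k, 0 <= a j k)%E ->
  (\sum_(0 <= m <oo) a (f m).1 (f m).2
   = \sum_(0 <= j <oo) \sum_(0 <= k <oo) a j k)%E.
Proof.
move=> fbij a0.
rewrite nneseries_esumT; last by move=> m.
rewrite -(@reindex_esum _ _ _ setT setT f (fun p => a p.1 p.2) fbij).
rewrite nneseries_esumT; last by move=> j; apply: nneseries_ge0.
under [RHS]eq_esum => j _ do rewrite (nneseries_esumT (a0 j)).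
rewrite esum_esum//; congr (esum _ _).
by apply/seteqP; split.
Qed.

Lemma nneseries_nth {R : realType} {I : Type} (w : I -> \bar R) (i0 : I)
    (l : seq I) : w i0 = 0%E ->
  (\sum_(0 <= k <oo) w (nth i0 l k) = \sum_(x <- l) w x)%E.
Proof.
move=> w0; rewrite (big_nth i0).
apply: (@lim_near_cst _ _ _ _ _ _) => //.
near=> n.
rewrite (big_cat_nat (n := size l))//=; last by near: n; exact: nbhs_infty_ge.
rewrite [X in (_ + X)%E]big1_seq ?adde0// => k /andP[_].
by rewrite mem_index_iota => /andP[lk _]; rewrite nth_default.
Unshelve. all: by end_near. Qed.

(** Covers of weight below [e / C] are refined term by term. Only terms of
weight at most 1 have to be refined, because covers of total weight above 1 can
be discarded. The finite refinements are padded to sequences with an index [i0]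
of weight 0 and then enumerated along a bijection between [nat] and
[nat * nat]. *)
Lemma null_cover_transfer {R : realType} {X : Type} {I : Type} {I' : choiceType}
    (D : set I) (S : I -> set X) (w : I -> \bar R)
    (D' : set I') (S' : I' -> set X) (w' : I' -> \bar R)
    (i0 : I') (C : R) (F : set X) :
  (forall i, 0 <= w i)%E -> (forall i, 0 <= w' i)%E -> 0 < C ->
  D' i0 -> w' i0 = 0%E ->
  (forall i, D i -> (w i <= 1)%E -> exists l : seq I',
     [/\ [set` l] `<=` D', S i `&` F `<=` \bigcup_(x in [set` l]) S' x &
         (\sum_(x <- l) w' x <= C%:E * w i)%E]) ->
  null_cover D S w F -> null_cover D' S' w' F.
Proof.
move=> w_ge0 w'_ge0 C0 Di0 wi0 refine nullF e e0.
have e'0 : 0 < Num.min 1 (e / C) by rewrite lt_min ltr01 divr_gt0.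
have [t [Dt Ft wt]] := nullF _ e'0.
have wt1 j : (w (t j) <= 1)%E.
  rewrite (@le_trans _ _ (\sum_(0 <= j <oo) w (t j))%E)//.
    apply: le_trans (nneseries_lim_ge j.+1 _) => //.
    by rewrite big_nat_recr//= leeDr// sume_ge0.
  by rewrite (le_trans (ltW wt))// lee_fin ge_min lexx.
have /choice[l lP] j := refine (t j) (Dt j) (wt1 j).
have /card_esym/ppcard_eqP[f] := card_nat2.
exists (fun m => nth i0 (l (f m).1) (f m).2); split.
- move=> m; have [lD _ _] := lP (f m).1.
  have [klt|kge] := ltnP (f m).2 (size (l (f m).1)).
    by apply: lD => /=; rewrite mem_nth.
  by rewrite nth_default.
- move=> p Fp; have [j _ Sp] := Ft p Fp.
  have [_ lS _] := lP j; have [x /= xl S'x] := lS p (conj Sp Fp).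
  have [m _ fm] : [set (f m) | m in setT] (j, index x (l j)).
    by apply: (@surj _ _ _ _ f).
  by exists m => //; rewrite fm/= nth_index.
- rewrite (nneseries_flatten (fun j k => w' (nth i0 (l j) k)) f)//.
  under eq_eseriesr => j _ do rewrite nneseries_nth//.
  apply: (@le_lt_trans _ _ (\sum_(0 <= j <oo) (C%:E * w (t j)))%E).
    apply: lee_nneseries => [j _ _|j _]; first exact: sume_ge0.
    by have [] := lP j.
  rewrite nneseriesZl// muleC -lte_pdivlMr// (lt_le_trans wt)//.
  by rewrite lee_fin ge_min lexx orbT.
Qed.

(** Positivity of [A] excludes the infimum [-oo]; if [A] is empty, the right-hand
side is [+oo]. *)
Lemma ereal_inf_le_affine {R : realType} (A A' : set R) (p q : R) :
  0 < p -> (forall x, A x -> 0 < x) -> (forall x, A x -> A' (p * x + q)) ->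
  (ereal_inf (EFin @` A') <= p%:E * ereal_inf (EFin @` A) + q%:E)%E.
Proof.
move=> p0 A0 AA'.
have infA0 : (0 <= ereal_inf (EFin @` A))%E.
  by apply: le_ereal_inf_tmp => _ [x Ax <-]; rewrite lee_fin ltW// A0.
case infA : (ereal_inf (EFin @` A)) infA0 => [r| |]// _; last first.
  by rewrite gt0_muley ?lte_fin// addye ?leey.
apply/lee_addgt0Pr => e e0.
have [_ [x Ax <-]] : exists2 y, (EFin @` A) y & (y < (r + e / p)%:E)%E.
  by apply: ereal_inf_lt; rewrite infA lte_fin ltrDl divr_gt0.
rewrite lte_fin => xlt.
apply: (@le_trans _ _ (p * x + q)%:E).
  by apply: ereal_inf_lbound; exists (p * x + q) => //; exact: AA'.
rewrite -EFinM -!EFinD lee_fin -addrA [q + e]addrC addrA lerD2r.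
have -> : p * r + e = p * (r + e / p).
  by rewrite mulrDr mulrCA divff ?gt_eqF ?mulr1.
by rewrite ler_wpM2l// ltW.
Qed.

(** * The two contents in terms of covers *)

Section contents.
Context {R : realType} {d : nat}.
Implicit Types (H beta : R) (F : set (R * 'rV[R]_d)).

Definition box_params : set (R * R * 'rV[R]_d) := [set q | 0 <= q.1.2].

Definition box_of H (q : R * R * 'rV[R]_d) : set (R * 'rV[R]_d) :=
  parabolic_box H q.1.1 q.1.2 q.2.

Definition box_weight beta (q : R * R * 'rV[R]_d) : \bar R :=
  (q.1.2 `^ beta)%:E.

Lemma box_weight_ge0 beta q : (0 <= box_weight beta q)%E.
Proof. by rewrite lee_fin powR_ge0. Qed.

Lemma parabolic_content_eq0P H beta F :
  parabolic_content H beta F = 0%E <->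
  null_cover box_params (box_of H) (box_weight beta) F.
Proof.
rewrite ereal_inf_eq0P; last first.
  move=> _ [a [delta [b [_ _ ->]]]].
  by apply: nneseries_ge0 => j _ _; rewrite lee_fin powR_ge0.
split=> null e /null.
- move=> [_ [a [delta [b [delta0 Fb ->]]]] lte].
  by exists (fun j => (a j, delta j, b j)).
- move=> [t [t0 Ft lte]]; eexists; last exact: lte.
  by exists (fun j => (t j).1.1), (fun j => (t j).1.2), (fun j => (t j).2).
Qed.

Lemma rho_content_eq0P H beta F :
  rho_content H beta F = 0%E <->
  null_cover [set U : set (R * 'rV[R]_d) | U `<=` half_space] id
    (fun U => diam_rho H U `^ beta)%E F.
Proof.
rewrite ereal_inf_eq0P; last first.
  move=> _ [U [_ _ ->]].
  by apply: nneseries_ge0 => j _ _; exact: poweR_ge0.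
split=> null e /null.
- by move=> [_ [U [UH FU ->]] lte]; exists U.
- by move=> [U [UH FU lte]]; eexists; [exists U | exact: lte].
Qed.

Lemma dim_Psi_le_affine H H' p q F : 0 < p ->
  (forall beta, 0 < beta -> parabolic_content H beta F = 0%E ->
     0 < p * beta + q /\ parabolic_content H' (p * beta + q) F = 0%E) ->
  (dim_Psi H' F <= p%:E * dim_Psi H F + q%:E)%E.
Proof.
move=> p0 tr; apply: ereal_inf_le_affine => // x [x0 ?] //; exact: tr.
Qed.

(** The degenerate box of size 0 serves as padding, and boxes of weight at most 1
have size at most 1, so that only [delta <= 1] matters. *)
Lemma parabolic_content_refine (H beta H' beta' C : R) F :
  0 < beta -> 0 < beta' -> 0 < C ->
  (forall (a delta : R) (b : 'rV[R]_d), 0 <= delta <= 1 ->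
     exists l : seq (R * R * 'rV[R]_d),
     [/\ [set` l] `<=` box_params,
         parabolic_box H a delta b `<=` \bigcup_(q in [set` l]) box_of H' q &
         (\sum_(q <- l) box_weight beta' q <= (C * delta `^ beta)%:E)%E]) ->
  parabolic_content H beta F = 0%E -> parabolic_content H' beta' F = 0%E.
Proof.
move=> beta0 beta'0 C0 refine /parabolic_content_eq0P nullF.
apply/parabolic_content_eq0P; move: nullF.
apply: (@null_cover_transfer R _ _ (R * R * 'rV[R]_d)%type
  _ _ _ _ _ _ (0, 0, 0) C) => //.
- by move=> q; exact: box_weight_ge0.
- by move=> q; exact: box_weight_ge0.
- by rewrite /box_params /=.
- by rewrite /box_weight/= powR0// gt_eqF.
- move=> [[a delta] b] /= delta0; rewrite /box_weight/= lee_fin => delta_beta1.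
  have delta1 : delta <= 1.
    rewrite leNgt; apply/negP => /(gt0_ltr_powR beta0).
    by rewrite !nnegrE ler01 powR1 ltNge delta_beta1 => /(_ isT delta0).
  have [|l [lD lS lw]] := refine a delta b; first by rewrite delta1 andbT.
  by exists l; split=> //; apply: subset_trans lS; exact: subIsetl.
Qed.

End contents.

(** * Auxiliary estimates *)

Lemma rV_norm_leP {R : realType} {d : nat} (v : 'rV[R]_d) (D : R) : 0 <= D ->
  `|v| <= D <-> (forall i, `|v ord0 i| <= D).
Proof.
move=> D0; rewrite /Num.norm/= mx_normrE; split=> [le_D i|le_D].
  apply: le_trans le_D.
  exact: (le_bigmax _ (fun ij : 'I_1 * 'I_d => `|v ij.1 ij.2|) (ord0, i)).
by apply: bigmax_le => // -[i j] _; rewrite /= ord1; exact: le_D.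
Qed.

Lemma powR_le_powR {R : realType} (x p q : R) :
  0 <= x <= 1 -> 0 < p -> p <= q -> x `^ q <= x `^ p.
Proof.
move=> /andP[x0 x1] p0 pq; have [->|xn0] := eqVneq x 0.
  by rewrite !powR0// gt_eqF// (lt_le_trans p0).
by apply: ger_powR => //; rewrite lt_def xn0 x0.
Qed.

Lemma powR_le1 {R : realType} (x p : R) : 0 <= x <= 1 -> 0 <= p -> x `^ p <= 1.
Proof.
move=> /andP[x0 x1] p0; have -> : 1 = 1 `^ p :> R by rewrite powR1.
by rewrite ge0_ler_powR// nnegrE.
Qed.

(** An interval of length [L] is covered by [n] intervals of length [c * L], with
[n] at most twice the ideal number [c^-1]. Bounding [n * c] instead of [n]
includes the degenerate case [c = 0], where one interval suffices; it arises
from boxes of size 0. *)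
Lemma interval_subdivision {R : realType} (L c : R) :
  0 <= L -> 0 <= c <= 1 -> (c = 0 -> L = 0) ->
  exists n : nat, n%:R * c <= 2 /\
    forall x, 0 <= x <= L ->
    exists k : 'I_n, k%:R * (c * L) <= x <= k%:R * (c * L) + c * L.
Proof.
move=> L0 /andP[c0 c1] cL; have [L_eq0|Ln0] := eqVneq L 0.
  exists 1%N; split=> [|x]; first by rewrite mul1r (le_trans c1)// ler1n.
  by rewrite L_eq0 => xL; exists ord0; rewrite !mulr0 addr0.
have cgt0 : 0 < c by rewrite lt_def c0 andbT; apply: contra_neq Ln0.
have Lgt0 : 0 < L by rewrite lt_def Ln0.
have cLgt0 := mulr_gt0 cgt0 Lgt0.
exists (Num.truncn c^-1).+1; split=> [|x /andP[x0 xL]].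
  have : (Num.truncn c^-1)%:R * c <= 1.
    by rewrite -ler_pdivlMr// mul1r truncn_le invr_ge0.
  by rewrite -natr1 mulrDl mul1r; lra.
have xq0 : 0 <= x / (c * L) by rewrite divr_ge0// ltW.
have lt_n : (Num.truncn (x / (c * L)) < (Num.truncn c^-1).+1)%N.
  by rewrite ltnS le_truncn// ler_pdivrMr// mulKf// gt_eqF.
exists (Ordinal lt_n) => /=.
have /andP[le1 /ltW le2] := truncn_itv xq0.
by rewrite -ler_pdivlMr// le1 -[X in _ + X]mul1r -mulrDl natr1 -ler_pdivrMr.
Qed.

Lemma sum_box_weight_const {R : realType} {d : nat} (K : finType) (beta v : R)
    (f : K -> R * R * 'rV[R]_d) : (forall k, (f k).1.2 = v) ->
  (\sum_(q <- [seq f k | k <- enum K]) box_weight beta q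
   = (#|K|%:R * v `^ beta)%:E)%E.
Proof.
move=> fv; rewrite big_map big_enum/=.
under eq_bigr => k _ do rewrite /box_weight fv.
by rewrite sumEFin sumr_const mulr_natl.
Qed.

Lemma sum_box_weight1 {R : realType} {d : nat} (beta : R)
    (q : R * R * 'rV[R]_d) :
  (\sum_(q <- [:: q]) box_weight beta q = (q.1.2 `^ beta)%:E)%E.
Proof. by rewrite big_seq1. Qed.

(** * Comparing boxes for two exponents *)

Section parabolic_comparison.
Context {R : realType} {d : nat} (H H' : R) (H0 : 0 < H) (HH' : H < H').
Context (F : set (R * 'rV[R]_d)).

Let H'0 : 0 < H' := lt_trans H0 HH'.

(** For [delta <= 1] the spatial side [delta `^ H'] is at most [delta `^ H], so
the same parameters describe a larger box for [H]. *)
Lemma dim_Psi_le : (dim_Psi H F <= dim_Psi H' F)%E.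
Proof.
rewrite -[leRHS]mul1e -[leRHS]adde0; apply: dim_Psi_le_affine => // beta beta0.
rewrite mul1r addr0 => null; split=> //; move: null.
apply: (@parabolic_content_refine _ _ _ _ _ _ 1) => // a delta b delta01.
have /andP[delta0 _] := delta01.
exists [:: (a, delta, b)]; split.
- by move=> q /=; rewrite inE => /eqP ->.
- move=> p [pt px]; exists (a, delta, b); first by rewrite /= inE.
  split=> // i; have /andP[-> /le_trans->//] := px i.
  by rewrite lerD2l powR_le_powR// ltW.
- by rewrite sum_box_weight1 mul1r.
Qed.

(** Replacing [delta] by [delta `^ (H / H')] keeps the spatial sides and, since
[H / H' < 1] and [delta <= 1], lengthens the time side. *)
Lemma dim_Psi_le_ratio : (dim_Psi H' F <= (H' / H)%:E * dim_Psi H F)%E.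
Proof.
rewrite -[leRHS]adde0; apply: dim_Psi_le_affine => [|beta beta0].
  exact: divr_gt0.
have betar0 : 0 < H' / H * beta by rewrite mulr_gt0// divr_gt0.
rewrite addr0 => null; split=> //; move: null.
apply: (@parabolic_content_refine _ _ _ _ _ _ 1) => // a delta b delta01.
have /andP[delta0 _] := delta01.
set q := (a, delta `^ (H / H'), b); exists [:: q]; split.
- by move=> ? /=; rewrite inE => /eqP ->; exact: powR_ge0.
- move=> p [/andP[pt1 pt2] px]; exists q; first by rewrite /= inE.
  split=> /=.
    rewrite pt1 (le_trans pt2)// lerD2l -[leLHS]powRr1//.
    by rewrite powR_le_powR ?divr_gt0// ler_pdivrMr// mul1r ltW.
  by move=> i; rewrite -powRrM divfK ?gt_eqF.
- rewrite sum_box_weight1 mul1r /= -powRrM lee_fin mulrA mulrA.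
  by rewrite divfK ?gt_eqF// divff ?gt_eqF// mul1r.
Qed.

(** The [H]-box with the same spatial sides as the [H']-box of size [delta] has
size [delta `^ (H' / H)], so the time interval is shrunk by the factor
[c = delta `^ (H' / H - 1)]. About [c^-1] of these boxes are needed, and the
additive constant [1 - H / H'] is what makes their total weight
[c^-1 * (c * delta `^ beta)]. *)
Lemma dim_Psi_le_time_subdivision :
  (dim_Psi H F <= (H / H')%:E * dim_Psi H' F + (1 - H / H')%:E)%E.
Proof.
have r1 : H / H' < 1 by rewrite ltr_pdivrMr// mul1r.
apply: dim_Psi_le_affine => [|beta beta0 null]; first exact: divr_gt0.
have beta'0 : 0 < H / H' * beta + (1 - H / H').
  by rewrite addr_gt0 ?subr_gt0// mulr_gt0// divr_gt0.
split=> //; move: null.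
apply: (@parabolic_content_refine _ _ _ _ _ _ 2) => // a delta b delta01.
have /andP[delta0 delta1] := delta01.
have s0 : 0 < H' / H - 1 by rewrite subr_gt0 ltr_pdivlMr// mul1r.
set c := delta `^ (H' / H - 1).
have c_delta : c * delta = delta `^ (H' / H).
  by rewrite mulrC mulr_powRB1// divr_gt0.
have [||n [nc cover]] := @interval_subdivision _ delta c delta0.
- by rewrite powR_ge0 powR_le1// ltW.
- by move=> /powR_eq0_eq0.
pose q (k : 'I_n) : R * R * 'rV[R]_d :=
  (a + k%:R * (c * delta), c * delta, b).
exists [seq q k | k <- enum 'I_n]; split.
- by move=> ? /mapP[k _ ->]; rewrite /box_params/= c_delta powR_ge0.
- move=> p [/andP[pt1 pt2] px].
  have [|k /andP[k1 k2]] := cover (p.1 - a).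
    by rewrite subr_ge0 pt1 lerBlDl.
  exists (q k) => /=.
    by apply/mapP; exists k => //; rewrite mem_enum.
  split=> [/=|i]; last by rewrite /= c_delta -powRrM divfK ?gt_eqF.
  by rewrite -lerBrDl k1 -addrA -lerBlDl.
- rewrite (@sum_box_weight_const _ _ _ _ (c * delta))// card_ord lee_fin.
  rewrite {1}c_delta -powRrM.
  have -> : H' / H * (H / H' * beta + (1 - H / H')) = (H' / H - 1) + beta.
    by field; rewrite !gt_eqF.
  rewrite powRD; last by rewrite gt_eqF// addr_gt0.
  by rewrite mulrA ler_wpM2r// powR_ge0.
Qed.

(** Passing from [H] to [H'] at fixed [delta] shrinks each of the [d] spatial
sides by the factor [c = delta `^ (H' - H)], so about [c^-1 ^+ d] boxes are
needed; raising the exponent by [(H' - H) * d] multiplies each weight by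
[c ^+ d]. *)
Lemma dim_Psi_le_space_subdivision :
  (dim_Psi H' F <= dim_Psi H F + ((H' - H) * d%:R)%:E)%E.
Proof.
have s0 : 0 < H' - H by rewrite subr_gt0.
rewrite -[dim_Psi H F]mul1e; apply: dim_Psi_le_affine => // beta beta0 null.
have beta'0 : 0 < 1 * beta + (H' - H) * d%:R.
  by rewrite mul1r ltr_wpDr// mulr_ge0// ltW.
split=> //; move: null.
apply: (@parabolic_content_refine _ _ _ _ _ _ (2 ^+ d)) =>
  // a delta b delta01.
have /andP[delta0 delta1] := delta01.
set c := delta `^ (H' - H).
have c0 : 0 <= c := powR_ge0 _ _.
have c_side : c * delta `^ H = delta `^ H'.
  by rewrite -powRD subrK// gt_eqF.
have [|||n [nc cover]] := @interval_subdivision _ (delta `^ H) c.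
- exact: powR_ge0.
- by rewrite c0 powR_le1// ltW.
- by move=> /powR_eq0_eq0 ->; rewrite powR0 ?gt_eqF.
rewrite c_side in cover.
(* [g] selects one piece of the subdivision along each spatial axis. *)
pose q (g : {ffun 'I_d -> 'I_n}) : R * R * 'rV[R]_d :=
  (a, delta, \row_i (b ord0 i + (g i)%:R * delta `^ H')).
exists [seq q g | g <- enum {ffun 'I_d -> 'I_n}]; split.
- by move=> ? /mapP[g _ ->].
- move=> p [pt px].
  have /choice[g gP] : forall i, exists k : 'I_n,
      k%:R * delta `^ H' <= p.2 ord0 i - b ord0 i
      <= k%:R * delta `^ H' + delta `^ H'.
    move=> i; apply: cover; have /andP[px1 px2] := px i.
    by rewrite subr_ge0 px1 lerBlDl.
  exists (q (finfun g)) => /=.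
    by apply/mapP; exists (finfun g) => //; rewrite mem_enum.
  split=> [//|i]; have /andP[g1 g2] := gP i.
  by rewrite /= mxE ffunE -lerBrDl g1 -addrA -lerBlDl.
- rewrite (@sum_box_weight_const _ _ _ _ delta)// card_ffun !card_ord lee_fin.
  rewrite mul1r powRD; last by rewrite gt_eqF// ltr_wpDr// mulr_ge0// ltW.
  rewrite powRrM powR_mulrn// natrX mulrCA mulrC -exprMn.
  by rewrite ler_wpM2r ?powR_ge0// lerXn2r// ?nnegrE ?mulr_ge0.
Qed.

End parabolic_comparison.

(** * Boxes and diameters in the parabolic metric *)

Lemma diam_rho_ge0 {R : realType} {d : nat} (H : R) (U : set (R * 'rV[R]_d)) :
  (0 <= diam_rho H U)%E.
Proof. by rewrite /diam_rho le_max lexx. Qed.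

Lemma rho_le_diam {R : realType} {d : nat} (H : R) (U : set (R * 'rV[R]_d)) p q :
  U p -> U q -> ((rho H p q)%:E <= diam_rho H U)%E.
Proof.
move=> Up Uq; rewrite /diam_rho le_max; apply/orP; right.
by apply: ereal_sup_ubound; exists p => //; exists q.
Qed.

Lemma diam_rho_set0 {R : realType} {d : nat} (H : R) :
  diam_rho H (set0 : set (R * 'rV[R]_d)) = 0%E.
Proof.
apply/eqP; rewrite eq_le diam_rho_ge0 andbT /diam_rho ge_max lexx/=.
by apply: ge_ereal_sup => _ [p []].
Qed.

Lemma diam_parabolic_box_le {R : realType} {d : nat} (H a delta : R)
    (b : 'rV[R]_d) (U : set (R * 'rV[R]_d)) : 0 < H -> 0 <= delta ->
  U `<=` parabolic_box H a delta b -> (diam_rho H U <= (delta `^ H)%:E)%E.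
Proof.
move=> H0 delta0 Ubox; rewrite /diam_rho ge_max lee_fin powR_ge0/=.
apply: ge_ereal_sup => _ [p /Ubox[pt px] [q /Ubox[qt qx] <-]].
rewrite lee_fin /rho ge_max; apply/andP; split.
  apply: ge0_ler_powR; rewrite ?nnegrE// ?(ltW H0)//.
  by rewrite ler_norml; move/andP: pt => [? ?]; move/andP: qt => [? ?]; lra.
apply/rV_norm_leP; first exact: powR_ge0.
move=> i; rewrite !mxE ler_norml.
by move/andP: (px i) => [? ?]; move/andP: (qx i) => [? ?]; lra.
Qed.

(** Every point of [U] is within [D] in space and within [D `^ H^-1] in time of
any fixed point [p] of [U]. The box of size [(2 * D) `^ H^-1] has spatial sides
exactly [2 * D], and its time side is at least [2 * D `^ H^-1] because
[2 <= 2 `^ H^-1] when [H <= 1]. *)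
Lemma sub_parabolic_box_diam {R : realType} {d : nat} (H D : R)
    (U : set (R * 'rV[R]_d)) : 0 < H <= 1 -> diam_rho H U = D%:E ->
  exists (a : R) (b : 'rV[R]_d), U `<=` parabolic_box H a ((2 * D) `^ H^-1) b.
Proof.
move=> /andP[H0 H1] diamU.
have D0 : 0 <= D by have := diam_rho_ge0 H U; rewrite diamU lee_fin.
have [->|/set0P[p Up]] := eqVneq U set0; first by exists 0, 0.
exists (p.1 - D `^ H^-1), (\row_i (p.2 ord0 i - D)) => q Uq.
have := rho_le_diam H U p q Up Uq.
rewrite diamU lee_fin /rho ge_max => /andP[lt lx].
split.
  have le_t : `|p.1 - q.1| <= D `^ H^-1.
    rewrite -[leLHS]powRr1// -(divff (lt0r_neq0 H0)) powRrM.
    by rewrite ge0_ler_powR ?nnegrE ?powR_ge0// invr_ge0 ltW.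
  have le_2 : 2 * D `^ H^-1 <= (2 * D) `^ H^-1.
    rewrite powRM// ler_wpM2r ?powR_ge0//.
    by rewrite le1r_powR ?ler1n// invf_ge1.
  by move: le_t; rewrite ler_norml => /andP[? ?]; lra.
move=> i; rewrite -powRrM mulVf ?gt_eqF// powRr1 ?mulr_ge0//.
have /(_ i) := (rV_norm_leP _ D D0).1 lx.
by rewrite !mxE ler_norml => /andP[? ?]; lra.
Qed.

(** Each covering set of diameter [D] is replaced by a box of size
[(2 * D) `^ H^-1]; the factor 2 costs only the constant [2 `^ beta]. *)
Lemma dim_Psi_le_dim_rho {R : realType} {d : nat} (H : R)
    (F : set (R * 'rV[R]_d)) : 0 < H <= 1 ->
  (dim_Psi H F <= H%:E * dim_rho H F)%E.
Proof.
move=> H01; have /andP[H0 H1] := H01.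
rewrite -[leRHS]adde0.
apply: ereal_inf_le_affine => // [? []//|beta [beta0]].
rewrite addr0 => /rho_content_eq0P null; split; first exact: mulr_gt0.
apply/parabolic_content_eq0P; move: null.
apply: (@null_cover_transfer R _ _ (R * R * 'rV[R]_d)%type
  _ _ _ _ _ _ (0, 0, 0) (2 `^ beta)).
- by move=> U; exact: poweR_ge0.
- by move=> q; exact: box_weight_ge0.
- exact: powR_gt0.
- by rewrite /box_params/=.
- by rewrite /box_weight/= powR0// gt_eqF// mulr_gt0.
- move=> U _ /=; have := diam_rho_ge0 H U.
  case diamU : (diam_rho H U) => [D| |]//; last first.
    by rewrite poweRyr ?gt_eqF.
  rewrite lee_fin => D0 _.
  have [a [b Ubox]] := sub_parabolic_box_diam H D U H01 diamU.
  set q := (a, (2 * D) `^ H^-1, b); exists [:: q]; split.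
  + by move=> ? /=; rewrite inE => /eqP ->; exact: powR_ge0.
  + by move=> p [/Ubox pbox _]; exists q; first by rewrite /= inE.
  + rewrite sum_box_weight1 /= -powRrM mulrA mulVf ?gt_eqF// mul1r.
    by rewrite powRM.
Qed.

(** Boxes may reach into negative times, so they are intersected with the half
space before they are used as covering sets for the metric content. *)
Lemma dim_rho_le_dim_Psi {R : realType} {d : nat} (H : R)
    (F : set (R * 'rV[R]_d)) : 0 < H -> F `<=` half_space ->
  (dim_rho H F <= H^-1%:E * dim_Psi H F)%E.
Proof.
move=> H0 hF.
rewrite -[leRHS]adde0.
apply: ereal_inf_le_affine => [|? []//|beta [beta0]]; first by rewrite invr_gt0.
have betar0 : 0 < H^-1 * beta by rewrite mulr_gt0// invr_gt0.
rewrite addr0 => /parabolic_content_eq0P null; split => //.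
apply/rho_content_eq0P; move: null.
apply: (@null_cover_transfer R _ _ (set (R * 'rV[R]_d)) _ _ _ _ _ _ set0 1).
- by move=> q; exact: box_weight_ge0.
- by move=> U; exact: poweR_ge0.
- by [].
- exact: sub0set.
- by rewrite diam_rho_set0 poweR0r// gt_eqF.
- move=> q q0 _; exists [:: box_of H q `&` half_space]; split.
  + by move=> U /=; rewrite inE => /eqP ->; exact: subIsetr.
  + move=> p [qp Fp]; exists (box_of H q `&` half_space).
      by rewrite /= inE.
    by split=> //; exact: hF.
  + rewrite big_seq1 mul1e /box_weight.
    have := @diam_parabolic_box_le _ _ H q.1.1 q.1.2 q.2
      (box_of H q `&` half_space) H0 q0 (@subIsetl _ _ _).
    have := diam_rho_ge0 H (box_of H q `&` half_space).
    case: diam_rho => [D| |]//; rewrite !lee_fin => D0 le_D.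
    apply: (@le_trans _ _ ((q.1.2 `^ H) `^ (H^-1 * beta))).
      by rewrite ge0_ler_powR ?nnegrE ?powR_ge0// ltW.
    by rewrite -powRrM mulrA divff ?gt_eqF// mul1r.
Qed.

Lemma dim_Psi_eq {R : realType} {d : nat} (H : R) (F : set (R * 'rV[R]_d)) :
  0 < H <= 1 -> F `<=` half_space -> dim_Psi H F = (H%:E * dim_rho H F)%E.
Proof.
move=> H01 hF; have /andP[H0 _] := H01.
apply/eqP; rewrite eq_le dim_Psi_le_dim_rho//= -lee_pdivlMl//.
exact: dim_rho_le_dim_Psi.
Qed.

Lemma dim_rho_ge0 {R : realType} {d : nat} (H : R) (F : set (R * 'rV[R]_d)) :
  (0 <= dim_rho H F)%E.
Proof.
by apply: le_ereal_inf_tmp => _ [beta [beta0 _] <-]; rewrite lee_fin ltW.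
Qed.

(** * The comparison theorem *)

Theorem proposition2p5 (R : realType) (d : nat) (hd : (1 <= d)%N)
    (F : set (R * 'rV[R]_d)) (hF : F `<=` half_space)
    (H H' : R) (hH : 0 < H < 1) (hH' : 0 < H' < 1) (hHH' : H < H') :
  (maxe (dim_Psi H F) ((H' / H)%:E * dim_Psi H F + 1 - (H' / H)%:E)
     <= dim_Psi H' F
     <= mine ((H' / H)%:E * dim_Psi H F)
             (dim_Psi H F + ((H' - H) * d%:R)%:E))%E
  /\
  (maxe ((H / H')%:E * dim_rho H F) (dim_rho H F + (H'^-1)%:E - (H^-1)%:E)
     <= dim_rho H' F
     <= mine (dim_rho H F)
             (d%:R%:E + (H / H')%:E * (dim_rho H F - d%:R%:E)))%E.
Proof.
have /andP[H0 H1] := hH; have /andP[H'0 H'1] := hH'.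
have lower1 := dim_Psi_le H H' H0 hHH' F.
have upper1 := dim_Psi_le_ratio H H' H0 hHH' F.
have lower2 := dim_Psi_le_time_subdivision H H' H0 hHH' F.
have upper2 := dim_Psi_le_space_subdivision H H' H0 hHH' F.
move: lower1 upper1 lower2 upper2.
have H01 : 0 < H <= 1 by rewrite H0 ltW.
have H'01 : 0 < H' <= 1 by rewrite H'0 ltW.
rewrite (dim_Psi_eq H F H01 hF) (dim_Psi_eq H' F H'01 hF).
have := dim_rho_ge0 H F; have := dim_rho_ge0 H' F.
case: (dim_rho H F) => [x| |]//; case: (dim_rho H' F) => [y| |]//.
- rewrite -!EFinM -!EFinD !lee_fin => y0 x0 lower1 upper1 lower2 upper2.
  rewrite -EFin_max -EFin_min -EFin_max -EFin_min !lee_fin !ge_max !le_min.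
  have Hn0 : H != 0 by rewrite gt_eqF.
  have H'n0 : H' != 0 by rewrite gt_eqF.
  rewrite lower1 upper1 upper2 !andbT /=; split;
    [|apply/andP; split; apply/andP; split].
  + rewrite -subr_ge0.
    have -> : H' * y - (H' / H * (H * x) + 1 - H' / H) =
        H' / H * (H / H' * (H' * y) + (1 - H / H') - H * x).
      by field; rewrite ?Hn0 ?H'n0.
    by rewrite mulr_ge0 ?subr_ge0 ?divr_ge0// ltW.
  + by rewrite mulrAC ler_pdivrMr// [y * _]mulrC.
  + rewrite -subr_ge0.
    have -> : y - (x + H'^-1 - H^-1) =
        H^-1 * (H / H' * (H' * y) + (1 - H / H') - H * x).
      by field; rewrite ?Hn0 ?H'n0.
    by rewrite mulr_ge0 ?subr_ge0 ?invr_ge0// ltW.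
  + by rewrite -(ler_pM2l H'0) (le_trans upper1)// mulrA divfK.
  + rewrite -subr_ge0.
    have -> : d%:R + H / H' * (x - d%:R) - y =
        H'^-1 * (H * x + (H' - H) * d%:R - H' * y).
      by field; rewrite H'n0.
    by rewrite mulr_ge0 ?subr_ge0 ?invr_ge0// ltW.
(* The four inequalities force both dimensions to be infinite together. *)
- by move=> _ _ _; rewrite gt0_muley ?lte_fin.
- by move=> _ _; rewrite gt0_muley ?lte_fin.
- have HH0 : 0 < H' / H by rewrite divr_gt0.
  have HH'0 : 0 < H / H' by rewrite divr_gt0.
  by rewrite !gt0_muley ?lte_fin.
Qed.
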